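(* Let $\star$, $\bigtriangledown$ and $\square$ be $\vee$-compatible relations on filters. Let $\mathbb{J}$ be a pointable and steady class of filters containing $\mathbb{F}_1$. Let $(X,\tau)$ be a topological space. (1) The following are equivalent: (a) $(X,\tau)$ is $\mathbb{J}^\star$-based; (b) $(X,\tau\vee\xi)$ is $\mathbb{J}^\star$-based for every $\mathbb{J}^{\star\star}$-based topology $\xi$ on $X$; (c) $(X,\tau\vee\xi)$ is $\mathbb{J}^\star$-based for every $\mathbb{J}$-based topology $\xi$ on $X$; (d) $(X,\tau\vee\xi)$ is $\mathbb{F}_1^\star$-based for every $\mathbb{J}$-based topology $\xi$ on $X$. (2) If $\mathbb{J}^\star$ is pointable, then the following are equivalent: (a) $(X,\tau)$ is $\mathbb{J}^{\star\square}$-based; (b) $(X,\tau\vee\xi)$ is $\mathbb{J}^{\star\star\square}$-based for every $\mathbb{J}^\star$-based topology $\xi$ on $X$; (c) $(X,\tau\vee\xi)$ is $\mathbb{F}_1^{\star\star\square}$-based for every $\mathbb{J}^\star$-based topology $\xi$ on $X$; (d) $(X,\tau\vee\xi)$ is $\mathbb{J}^{\square}$-based for every $\mathbb{J}^\star$-based topology $\xi$ on $X$; (e) $(X,\tau\vee\xi)$ is $\mathbb{F}_1^{\square}$-based for every $\mathbb{J}^\star$-based topology $\xi$ on $X$. (3) If $(X,\tau)$ is $\mathbb{J}^{\square\bigtriangledown}$-based, then $(X,\tau\vee\xi)$ is $\mathbb{J}^{\star\bigtriangledown}$-based for every $\mathbb{J}^{\star\square}$-based topology $\xi$ on $X$.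
   Context: Filters are proper. $\mathbb{F}(X)$ is the set of filters on $X$. A class $\mathbb{J}$ of filters prescribes for each set $X$ a subset $\mathbb{J}(X)\subseteq\mathbb{F}(X)$. $\mathbb{F}_1$ is the class of principal filters $A^\uparrow=\{B\subseteq X: A\subseteq B\}$ ($A\neq\varnothing$). Two families of sets mesh, $\mathcal{F}\#\mathcal{G}$, if $F\cap G\ne\varnothing$ for all $F\in\mathcal{F}$, $G\in\mathcal{G}$. If filters $\mathcal{F},\mathcal{G}$ mesh, $\mathcal{F}\vee\mathcal{G}$ is the filter generated by $\{F\cap G: F\in\mathcal{F},G\in\mathcal{G}\}$. $\mathcal{F}\wedge\mathcal{G}=\mathcal{F}\cap\mathcal{G}$ is the infimum of filters. A symmetric relation $\star$ on $\mathbb{F}(X)$ (given for every set $X$) is $\vee$-compatible if $\mathcal{F}\star\mathcal{G}$ whenever $\mathcal{F},\mathcal{G}$ do not mesh, and $\mathcal{F}\star(\mathcal{G}\vee\mathcal{H})\Rightarrow(\mathcal{F}\vee\mathcal{H})\star\mathcal{G}$ whenever $\mathcal{G}\#\mathcal{F}$ and $\mathcal{F}\#\mathcal{H}$ (and $\mathcal{G}\vee\mathcal{H}$ is defined, i.e. $\mathcal{G}\#\mathcal{H}$). The polar of a class is $\mathbb{J}^\star(X)=\{\mathcal{F}\in\mathbb{F}(X): \mathcal{F}\star\mathcal{G}\text{ for all }\mathcal{G}\in\mathbb{J}(X)\}$; iterated polars are read left to right: $\mathbb{J}^{\star\square}=(\mathbb{J}^\star)^\square$, etc. A class $\mathbb{J}$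 is steady if $\mathcal{F}\vee\mathcal{H}\in\mathbb{J}(X)$ whenever $\mathcal{F},\mathcal{H}\in\mathbb{J}(X)$ and $\mathcal{F}\#\mathcal{H}$. It is pointable if $\mathcal{F}\wedge\{x\}^\uparrow\in\mathbb{J}(X)$ whenever $\mathcal{F}\in\mathbb{J}(X)$, for every set $X$ and every $x\in X$. A topological space is $\mathbb{J}$-based if all its neighborhood filters are $\mathbb{J}$-filters (a topology is $\mathbb{J}$-based if the corresponding space is). $\tau\vee\xi$ is the supremum of the topologies $\tau$ and $\xi$. *)

(* Defs.v *)
From HB Require Import structures.
From mathcomp Require Import all_boot.
From mathcomp Require Import all_classical.
From mathcomp Require Import topology_structure supremum_topology.

Set Implicit Arguments.
Unset Strict Implicit.
Unset Printing Implicit Defensive.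

Local Open Scope classical_set_scope.

(* [pfilter_on X], the type of proper filters on [X], plays the role of
   F(X). *)
Definition class_of_filters := forall X : Type, set (pfilter_on X).

Definition relation_on_filters :=
  forall X : Type, pfilter_on X -> pfilter_on X -> Prop.

Section FilterOperations.
Context {X : Type}.
Implicit Types F G H : pfilter_on X.

Lemma principal_proper (A : set X) : A !=set0 -> ProperFilter (globally A).
Proof. by case=> a Aa; exact: (globally_properfilter Aa). Qed.

Definition principal (A : set X) (A0 : A !=set0) : pfilter_on X :=
  PFilterPack (globally A) (principal_proper A0).

Definition point_filter (x : X) : pfilter_on X :=
  principal (ex_intro [set x] x (erefl x)).

Lemma join_proper F G : F `#` G ->
  ProperFilter (filter_from [set U : set X * set X | F U.1 /\ G U.2]
                            (fun U => U.1 `&` U.2)).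
Proof.
move=> FG; apply: filter_from_proper; last by move=> [A B] [FA GB]; exact: FG.
apply: filter_from_filter.
  by exists (setT, setT); split; exact: filterT.
move=> [A B] [A' B'] [/= FA GB] [/= FA' GB'].
exists (A `&` A', B `&` B'); first by split; exact: filterI.
by move=> x /= [[? ?] [? ?]].
Qed.

(* The join is a proper filter only when [F] and [G] mesh. *)
Definition filter_join F G (FG : F `#` G) : pfilter_on X :=
  PFilterPack _ (join_proper FG).

Lemma meet_proper F G :
  ProperFilter ((F : set_system X) `&` (G : set_system X)).
Proof.
split; first by case=> F0 _; exact: (filter_not_empty F F0).
split.
- by split; exact: filterT.
- by move=> A B [FA GA] [FB GB]; split; exact: filterI.
- by move=> A B AB [FA GA]; split; exact: filterS AB _.
Qed.

Definition filter_meet F G : pfilter_on X := PFilterPack _ (meet_proper F G).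

End FilterOperations.

Definition principal_filters : class_of_filters := fun X =>
  [set F | exists (A : set X) (A0 : A !=set0), F = principal A0].
Arguments principal_filters : clear implicits.

Definition join_compatible (star : relation_on_filters) : Prop :=
  forall X : Type,
  [/\ forall F G : pfilter_on X, star X F G -> star X G F,
      forall F G : pfilter_on X, ~ F `#` G -> star X F G
    & forall (F G H : pfilter_on X) (GH : G `#` H) (FH : F `#` H),
        G `#` F -> star X F (filter_join GH) -> star X (filter_join FH) G].

Definition polar (star : relation_on_filters) (J : class_of_filters) :
    class_of_filters :=
  fun X => [set F | forall G, J X G -> star X F G].
Arguments polar : clear implicits.

Definition steady (J : class_of_filters) : Prop :=
  forall (X : Type) (F H : pfilter_on X) (FH : F `#` H),
    J X F -> J X H -> J X (filter_join FH).

Definition pointable (J : class_of_filters) : Prop :=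
  forall (X : Type) (F : pfilter_on X) (x : X),
    J X F -> J X (filter_meet F (point_filter x)).

Definition nbhs_pfilter_on (X : Type) (tau : Topological X) (x : X) :
    pfilter_on X :=
  let T := Topological.Pack tau in
  PFilterPack (@nbhs T T x) (@nbhs_pfilter T x).

(* An element of [Topological X] is a topology on [X]; it also records a choice
   structure on [X], on which nothing here depends. *)
Definition based (J : class_of_filters) (X : Type) (tau : Topological X) : Prop :=
  forall x : X, J X (nbhs_pfilter_on tau x).

Definition join_topology (X : choiceType) (tau xi : Topological X) :
    Topological X :=
  Topological.on (sup_topology (fun b : bool => if b then tau else xi)).

(* Main.v *)
Require Import Defs.
From HB Require Import structures.
From mathcomp Require Import all_boot.
From mathcomp Require Import all_classical.
From mathcomp Require Import topology_structure supremum_topology.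

(** The neighborhood filter of a point [x] for the join of two topologies is
the join of the two neighborhood filters of [x], so every claim that passes
from [tau] to its joins is a claim on joins of filters.  These all come from
one exchange argument, [polar_join]: to bound [F \/ H] against [G], compatibility
moves [H] to the other side, so it is enough to know where [H \/ G] lies.  With
[J] steady this gives successively that [J^* \/ J] and [J^* \/ J^**] are contained
in [J^*], and iterating the exchange once more gives every implication from
[tau] to its joins.

For the converses, [polar_based_of_join], let [N] be the neighborhood filter of
[tau] at [x] and [G] a filter of the class [K]; the goal is [N * G].  The
topology that is discrete off [x] and whose neighborhood filter at [x] is
[G /\ {x}] is [K]-based because [K] is pointable, so by hypothesis
[N \/ (G /\ {x})] is related to every principal filter.  Applying this to a
suitable member [A] of [G] with [(G /\ {x}) \/ A = G] and exchanging once more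
gives [N * G] ([filter_meet_split]: if some member of [G] misses [x], take it
as [A]; otherwise [G /\ {x} = G] already).

Discreteness off [x] requires the point filters to lie in [K].  For [K = J] they
do, being principal.  For [K = J^*] they do as soon as [J^*] has an element [F]
on [X]: then [F /\ {x}] is in [J^*] and [{x}] is its join with the element
[{x}] of [J].  If [J^*] has no element on [X] there is nothing to prove. *)

Set Implicit Arguments.
Unset Strict Implicit.
Unset Printing Implicit Defensive.

Local Open Scope classical_set_scope.

(** * Joins and meets of proper filters *)

Section Filters.
Context {X : Type}.
Implicit Types F G H : pfilter_on X.

Lemma pfilter_ext F G : (forall A, F A <-> G A) -> F = G.
Proof.
case: F G => F FP [G GP] /= FG.
have E : F = G by apply/funext => A; exact/propext/FG.
by move: FP GP; rewrite {}E => FP GP; congr PFilterPack; exact: Prop_irrelevance.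
Qed.

Lemma filter_joinE F G (FG : F `#` G) A :
  filter_join FG A <-> exists B C, [/\ F B, G C & B `&` C `<=` A].
Proof.
split; first by case=> -[B C] [/= FB GC] BCA; exists B, C.
by move=> [B [C [FB GC BCA]]]; exists (B, C).
Qed.

Lemma sub_filter_joinl F G (FG : F `#` G) A : F A -> filter_join FG A.
Proof.
by move=> FA; apply/filter_joinE; exists A, setT; split;
  [|exact: filterT|move=> ? []].
Qed.

Lemma sub_filter_joinr F G (FG : F `#` G) A : G A -> filter_join FG A.
Proof.
by move=> GA; apply/filter_joinE; exists setT, A; split;
  [exact: filterT| |move=> ? []].
Qed.

Lemma filter_joinC F G (FG : F `#` G) (GF : G `#` F) :
  filter_join FG = filter_join GF.
Proof.
apply: pfilter_ext => A; split=> /filter_joinE[B [C [PB PC BCA]]];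
  by apply/filter_joinE; exists C, B; split=> //; rewrite setIC.
Qed.

Lemma meets_sym F G : F `#` G -> G `#` F.
Proof. by rewrite meetsC. Qed.

Lemma filter_join_meetsl F G H (FG : F `#` G) : filter_join FG `#` H -> F `#` H.
Proof. by move=> m A B FA HB; apply: m => //; exact: sub_filter_joinl. Qed.

Lemma filter_join_meetsr F G H (FG : F `#` G) : filter_join FG `#` H -> G `#` H.
Proof. by move=> m A B GA HB; apply: m => //; exact: sub_filter_joinr. Qed.

Lemma principal_meets (A : set X) (A0 : A !=set0) F :
  F A -> principal A0 `#` F.
Proof.
move=> FA B C AB FC; have [x [Ax Cx]] := filter_ex (filterI FA FC).
by exists x; split=> //; exact: AB.
Qed.

Lemma principal_filters_point x : principal_filters X (point_filter x).
Proof. by exists [set x], (ex_intro [set x] x erefl). Qed.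

Lemma filter_join_point F x (xF : point_filter x `#` F) :
  filter_join xF = point_filter x.
Proof.
apply: pfilter_ext => A; split; last exact: sub_filter_joinl.
move=> /filter_joinE[B [C [xB FC BCA]]] _ ->; apply: BCA; split; first exact: xB.
by have [y [-> Cy]] := xF [set x] C (fun _ => id) FC.
Qed.

(** A filter can be recovered from its meet with a point filter by joining one
of its own members. *)
Lemma filter_meet_split F x :
  exists (A : set X) (A0 : A !=set0), F A /\
    forall m : filter_meet F (point_filter x) `#` principal A0,
      filter_join m = F.
Proof.
(* If some member of [F] misses [x], then [A] misses [x] as well, and joining
   [A] removes the point [x] that the meet added; otherwise the meet is [F]. *)
have [A [FA Ax]] : exists A, F A /\ (A x -> forall C, F C -> C x).
  have [[A [FA nAx]]|Fx] := pselect (exists A, F A /\ ~ A x).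
    by exists A; split=> // /nAx.
  exists setT; split=> [|_ C FC]; first exact: filterT.
  by apply: contrapT => nCx; apply: Fx; exists C.
exists A, (filter_ex FA); split=> // m.
apply: pfilter_ext => C; split.
  move=> /filter_joinE[B [D [[FB _] AD BDC]]].
  by apply: filterS BDC _; apply: filterI => //; exact: filterS AD FA.
move=> FC; apply/filter_joinE; exists (C `|` [set x]), A; split.
- split; first by apply: filterS FC => y; left.
  by move=> y ->; right.
- by [].
- by move=> y [[//|->] /Ax]; exact.
Qed.

End Filters.

(** * Polars and joins *)

Section Polars.
Context {star : relation_on_filters} (star_compat : join_compatible star).
Implicit Types J K : class_of_filters.

Lemma sub_bipolar J X : J X `<=` polar star (polar star J) X.
Proof. by move=> F JF G /(_ F JF); have [sym _ _] := star_compat X; exact: sym. Qed.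

Lemma polar_anti J K X : J X `<=` K X -> polar star K X `<=` polar star J X.
Proof. by move=> JK F FK G /JK; exact: FK. Qed.

(** Compatibility trades [(F \/ H) * G] for [F * (H \/ G)]; when [F \/ H] and
[G] do not mesh, they are related for free. *)
Lemma polar_join J K X (F H : pfilter_on X) (FH : F `#` H) :
  polar star J X F ->
  (forall (G : pfilter_on X) (HG : H `#` G), K X G -> J X (filter_join HG)) ->
  polar star K X (filter_join FH).
Proof.
have [_ nomesh swap] := star_compat X; move=> FJ HKJ G KG.
have [m|] := pselect (filter_join FH `#` G); last exact: nomesh.
have HG := filter_join_meetsr m.
have GH := meets_sym HG.
apply: (swap _ _ _ GH); first exact/meets_sym/(filter_join_meetsl m).
by rewrite (filter_joinC GH HG); apply: FJ; exact: HKJ.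
Qed.

Lemma polar_join_steady J X (F H : pfilter_on X) (FH : F `#` H) :
  steady J -> polar star J X F -> J X H -> polar star J X (filter_join FH).
Proof. by move=> Jst FJ JH; apply: (polar_join FH FJ) => G HG; exact: Jst. Qed.

(** The exchange is applied to [H], whose polarity is against [J^*]: what has
to lie in [J^*] is then [F \/ G] for [G] in [J]. *)
Lemma polar_join_bipolar J X (F H : pfilter_on X) (FH : F `#` H) :
  steady J -> polar star J X F -> polar star (polar star J) X H ->
  polar star J X (filter_join FH).
Proof.
move=> Jst FJ HJ; have HF := meets_sym FH.
rewrite (filter_joinC FH HF); apply: (polar_join HF HJ) => G FG.
exact: polar_join_steady.
Qed.

End Polars.

(** * Neighborhood filters of joins and of almost discrete topologies *)

Section Topologies.
Variable X : choiceType.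
Implicit Types tau xi : Topological X.

Lemma nbhs_meets tau xi x : nbhs_pfilter_on tau x `#` nbhs_pfilter_on xi x.
Proof.
move=> A B tA xB; exists x; split.
  exact: (@nbhs_singleton (Topological.Pack tau)).
exact: (@nbhs_singleton (Topological.Pack xi)).
Qed.

(** The supremum topology is the coarsest one finer than both, so a filter
converges for it when it converges for both; the filter join is the smallest
filter that does. *)
Lemma nbhs_join_topology tau xi x :
  nbhs_pfilter_on (join_topology tau xi) x = filter_join (@nbhs_meets tau xi x).
Proof.
set m := @nbhs_meets tau xi x.
have cvg_supE (F : pfilter_on X) :=
  @cvg_sup X bool (fun b => if b then tau else xi) F x (pfilter_class F).
apply: pfilter_ext => A; split.
  apply: (cvg_supE (filter_join m)).2.
  by case=> B nB; [exact: (sub_filter_joinl m) | exact: (sub_filter_joinr m)].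
have sub := (cvg_supE (nbhs_pfilter_on (join_topology tau xi) x)).1 (fun=> id).
move=> /filter_joinE[B [C [tB xC BCA]]].
by apply: filterS BCA _; apply: filterI; [exact: (sub true)|exact: (sub false)].
Qed.

Lemma based_join (J K L : class_of_filters) tau xi :
  (forall (F H : pfilter_on X) (FH : F `#` H),
    J X F -> K X H -> L X (filter_join FH)) ->
  based J tau -> based K xi -> based L (join_topology tau xi).
Proof. by move=> JKL Jt Kx x; rewrite nbhs_join_topology; exact: JKL. Qed.

(** A copy of [X] on which to put the topology that is discrete off [x] and whose
neighborhood filter at [x] is [G /\ {x}]. *)
Definition isolating (x : X) (G : pfilter_on X) : Type := X.

Section Isolating.
Variables (x : X) (G : pfilter_on X).
Local Notation T := (isolating x G).

Definition isolating_nbhs (y : T) : pfilter_on T :=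
  if y == x :> X then filter_meet G (point_filter x) else point_filter y.

Lemma isolating_nbhs_refl (y : T) A : isolating_nbhs y A -> A y.
Proof.
rewrite /isolating_nbhs; case: eqP => [->|_]; last exact.
by case=> _; exact.
Qed.

HB.instance Definition _ := Choice.on T.
HB.instance Definition _ := hasNbhs.Build T isolating_nbhs.

Lemma isolating_nbhs_nbhs (y : T) A :
  isolating_nbhs y A -> isolating_nbhs y (isolating_nbhs^~ A).
Proof.
have [-> xA|yx] := eqVneq (y : X) x; last first.
  rewrite {1 2}/isolating_nbhs (negbTE yx) => yA _ ->.
  by rewrite /isolating_nbhs (negbTE yx).
apply: filterS (xA) => z Az; have [-> //|zx] := eqVneq (z : X) x.
by rewrite /isolating_nbhs (negbTE zx) => _ ->.
Qed.

HB.instance Definition _ := Nbhs_isNbhsTopological.Build T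
  (fun y => pfilter_class (isolating_nbhs y))
  isolating_nbhs_refl isolating_nbhs_nbhs.

Definition isolating_topology : Topological X := Topological.on T.

End Isolating.

Lemma nbhs_isolating x G y :
  nbhs_pfilter_on (isolating_topology x G) y = @isolating_nbhs x G y.
Proof. exact: pfilter_ext. Qed.

(** Testing [tau] against all [K]-based topologies detects [polar star K], even
when the joins are only tested against principal filters. *)
Lemma polar_based_of_join (star : relation_on_filters) (K : class_of_filters)
    tau :
  join_compatible star -> pointable K ->
  (forall (F : pfilter_on X) x, K X F -> K X (point_filter x)) ->
  (forall xi, based K xi ->
    based (polar star principal_filters) (join_topology tau xi)) ->
  based (polar star K) tau.
Proof.
move=> star_compat K_pt K_point tau_join x G KG.
have [sym nomesh swap] := star_compat X.
have [tG|] := pselect (nbhs_pfilter_on tau x `#` G); last exact: nomesh.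
have /tau_join/(_ x) : based K (isolating_topology x G).
  move=> y; rewrite nbhs_isolating /isolating_nbhs.
  by case: ifP => _; [exact: K_pt | exact: K_point KG].
(* The mesh proof is generalized so that the neighborhood filter it depends on
   can be rewritten. *)
rewrite nbhs_join_topology; move: (@nbhs_meets _ _ _).
rewrite nbhs_isolating /isolating_nbhs eqxx => tGx tau_polar.
have [A [A0 [GA GE]]] := filter_meet_split G x.
have AGx : filter_meet G (point_filter x) `#` principal A0.
  apply/meets_sym => B C AB [GC _].
  exact: principal_meets GA _ _ AB GC.
have AG : principal A0 `#` filter_meet G (point_filter x) by exact: meets_sym.
rewrite -(GE AGx) (filter_joinC AGx AG); apply: (sym).
apply: (swap _ _ _ tGx).
  by move=> B C tB sAC; apply: tG => //; exact: filterS sAC GA.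
by apply: sym; apply: tau_polar; exists A, A0.
Qed.

End Topologies.

(** * Characterizations of polar-based topologies *)

Theorem corollary11 (star tri box : relation_on_filters) (J : class_of_filters)
    (star_compat : join_compatible star)
    (tri_compat : join_compatible tri)
    (box_compat : join_compatible box)
    (J_pointable : pointable J) (J_steady : steady J)
    (F1_sub_J : forall X : Type, principal_filters X `<=` J X)
    (X : choiceType) (tau : Topological X) :
  [/\ [<-> based (polar star J) tau;
           forall xi : Topological X, based (polar star (polar star J)) xi ->
             based (polar star J) (join_topology tau xi);
           forall xi : Topological X, based J xi ->
             based (polar star J) (join_topology tau xi);
           forall xi : Topological X, based J xi ->
             based (polar star principal_filters) (join_topology tau xi)],
      pointable (polar star J) ->
      [<-> based (polar box (polar star J)) tau;
           forall xi : Topological X, based (polar star J) xi ->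
             based (polar box (polar star (polar star J)))
               (join_topology tau xi);
           forall xi : Topological X, based (polar star J) xi ->
             based (polar box (polar star (polar star principal_filters)))
               (join_topology tau xi);
           forall xi : Topological X, based (polar star J) xi ->
             based (polar box J) (join_topology tau xi);
           forall xi : Topological X, based (polar star J) xi ->
             based (polar box principal_filters) (join_topology tau xi)]
    & based (polar tri (polar box J)) tau ->
      forall xi : Topological X, based (polar box (polar star J)) xi ->
        based (polar tri (polar star J)) (join_topology tau xi)].
Proof.
have F1J : principal_filters X `<=` J X by exact: F1_sub_J.
have join_steady Y (F H : pfilter_on Y) (FH : F `#` H) :
    polar star J Y F -> J Y H -> polar star J Y (filter_join FH).
  exact: polar_join_steady.
split.
- tfae.
  + by move=> tJ xi; apply: based_join tJ => F H FH; exact: polar_join_bipolar.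
  + by move=> tJ xi xiJ; apply: tJ => x; apply: sub_bipolar => //; exact: xiJ.
  + by move=> tJ xi xiJ x; apply: (polar_anti F1J); exact: tJ.
  + apply: polar_based_of_join => // F x _.
    exact/F1J/principal_filters_point.
- move=> Js_pointable.
  have Js_point (F : pfilter_on X) x :
      polar star J X F -> polar star J X (point_filter x).
    move=> FJ.
    have xF : point_filter x `#` filter_meet F (point_filter x).
      by move=> B C xB [_ xC]; exists x; split; [exact: xB | exact: xC].
    have Fx := meets_sym xF.
    rewrite -(filter_join_point xF) (filter_joinC xF Fx).
    apply: join_steady; first exact: Js_pointable.
    exact/F1J/principal_filters_point.
  have ab : based (polar box (polar star J)) tau ->
      forall xi, based (polar star J) xi ->
      based (polar box (polar star (polar star J))) (join_topology tau xi).
    move=> tJ xi; apply: based_join tJ => F H FH FJ HJ.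
    by apply: (polar_join box_compat FH FJ) => K HK; exact: polar_join_bipolar.
  have ea := polar_based_of_join box_compat Js_pointable Js_point.
  have bipolar_box (K : class_of_filters) (xi : Topological X) :
      based (polar box (polar star (polar star K))) xi ->
      based (polar box K) xi.
    by move=> xiK x; apply: (polar_anti _ (xiK x)); exact: (sub_bipolar star_compat).
  tfae.
  + exact: ab.
  + move=> tb xi xiJ x; apply: (polar_anti _ (tb xi xiJ x)).
    exact/polar_anti/polar_anti.
  (* The third statement gives the fourth through the fifth, first and second. *)
  + move=> tc xi xiJ; apply: (bipolar_box); apply: ab => //.
    by apply: ea => zeta zetaJ; apply: bipolar_box; exact: tc.
  + by move=> td xi xiJ x; apply: (polar_anti F1J); exact: td.
  + exact: ea.
- move=> tJ xi; apply: based_join tJ => F H FH FJ HJ.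
  apply: (polar_join tri_compat FH FJ) => K HK KJ.
  by apply: (polar_join box_compat HK HJ) => G KG; exact: join_steady.
Qed.
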